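(* Let $X$ and $E$ be Banach spaces, let $Y$ be a (closed) subspace of $E$ equipped with the norm of $E$, and let $J\colon Y\to E$ be the natural embedding operator. If $G\colon X\to Y$ is a Daugavet center, then there is a norm on $E$, equivalent to the original one, which coincides with the original norm on $Y$ and such that $J\circ G\colon X\to E$ is a Daugavet center when $E$ is equipped with this new norm.
   Context: All Banach spaces are real. For Banach spaces $X,Z$, a bounded linear operator $G\colon X\to Z$ is called a Daugavet center if $\|G+T\|=\|G\|+\|T\|$ for every bounded linear rank-$1$ operator $T\colon X\to Z$. *)

(* Defs.v *)
From HB Require Import structures.
From mathcomp Require Import all_boot all_order all_algebra.
From mathcomp Require Import boolp classical_sets functions reals.
From mathcomp Require Import topology normedtype sequences.

Set Implicit Arguments.
Unset Strict Implicit.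
Unset Printing Implicit Defensive.

Import Order.TTheory GRing.Theory Num.Theory.
Import numFieldNormedType.Exports.

Local Open Scope classical_set_scope.
Local Open Scope ring_scope.

(* Norms as first-class values, so that one can quantify over the norms on a
   given vector space.  Nonnegativity follows from the axioms, as in the
   library factory Lmodule_isNormed. *)
Record vnorm (R : realType) (V : lmodType R) := VNorm {
  vnorm_fun :> V -> R;
  vnorm_leD : forall x y, vnorm_fun (x + y) <= vnorm_fun x + vnorm_fun y;
  vnormZ : forall (a : R) x, vnorm_fun (a *: x) = `|a| * vnorm_fun x;
  vnorm_eq0 : forall x, vnorm_fun x = 0 -> x = 0 }.

(* The vector space V normed by p: its `|x| is p x, by conversion, and its
   topology is the one induced by p. *)
Definition with_norm (R : realType) (V : lmodType R) (p : vnorm V) : Type := V.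

HB.instance Definition _ (R : realType) (V : lmodType R) (p : vnorm V) :=
  GRing.Lmodule.on (with_norm p).
HB.instance Definition _ (R : realType) (V : lmodType R) (p : vnorm V) :=
  @Lmodule_isNormed.Build R (with_norm p) p
    (@vnorm_leD _ _ p) (@vnormZ _ _ p) (@vnorm_eq0 _ _ p).

Section restricted_norm.
Context (R : realType) (E : normedModType R) (S : pred E) (Y : subLmodType S).

Let N (y : Y) : R := `|val y|.

Let N_leD x y : N (x + y) <= N x + N y.
Proof. by rewrite /N raddfD ler_normD. Qed.

Let NZ (a : R) x : N (a *: x) = `|a| * N x.
Proof. by rewrite /N linearZ normrZ. Qed.

Let N_eq0 x : N x = 0 -> x = 0.
Proof. by move/normr0_eq0 => x0; apply: val_inj; rewrite x0 raddf0. Qed.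

Definition restricted_norm : vnorm Y := VNorm N_leD NZ N_eq0.

End restricted_norm.

Definition equivalent_to_norm (R : realType) (E : normedModType R)
    (p : vnorm E) : Prop :=
  exists a b : R, [/\ 0 < a, 0 < b &
    forall x : E, a * `|x| <= p x /\ p x <= b * `|x|].

Section operators.
Context (R : realType) (X Z : normedModType R).
Implicit Types f G T : X -> Z.

Definition bounded_operator f : Prop := linear f /\ bounded_fun_norm f.

(* Meaningful for bounded operators only: sup is 0 on unbounded sets. *)
Definition opnorm f : R := sup [set `|f x| | x in [set x : X | `|x| <= 1]].

Definition rank_one f : Prop :=
  exists2 z : Z, z != 0 & range f = range (fun a : R => a *: z).

Definition daugavet_center G : Prop :=
  bounded_operator G /\
  forall T, bounded_operator T -> rank_one T ->
    opnorm (G \+ T) = opnorm G + opnorm T.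

End operators.

(* Main.v *)
(* By Zorn's lemma there is a minimal seminorm q on E among those that are
   dominated by the norm of E and coincide with it on Y.  Minimality forces
   the Daugavet equation for q: suppose that a functional f, a vector z and
   e > 0 satisfy q (G x + f(x) z) <= |G| + |f| q z - e for every x in the unit
   ball at which |f| is almost attained.  With k = max (q z - e / |f|) 0, the
   seminorm q' w = inf_t (q (w - t z) + |t| k) is at most q, has q' z <= k < q z,
   and still dominates the norm on Y: the Daugavet equation of G for f and y
   provides x in the ball with |f x| and |G x + f(x) y| almost maximal, and
   |G x + f(x) y| <= q (G x + f(x) z) + |f x| q (y - z) gives
   |y| <= q (y - z) + k.
   Adding the distance to Y makes q an equivalent norm; the equation
   survives since G x does not change the distance of f(x) z to Y. *)
Require Import Defs.
From HB Require Import structures.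
From mathcomp Require Import all_boot all_order all_algebra.
From mathcomp Require Import boolp classical_sets functions reals.
From mathcomp Require Import topology normedtype sequences.
From mathcomp Require Import lra.

Set Implicit Arguments.
Unset Strict Implicit.
Unset Printing Implicit Defensive.

Import Order.TTheory GRing.Theory Num.Theory.
Import numFieldNormedType.Exports.

Local Open Scope classical_set_scope.
Local Open Scope ring_scope.

(** * Seminorms and minimality by Zorn's lemma *)

Definition seminorm (R : realType) (V : lmodType R) (q : V -> R) : Prop :=
  (forall x y, q (x + y) <= q x + q y) /\
  (forall (a : R) x, q (a *: x) = `|a| * q x).

Lemma norm_seminorm (R : realType) (E : normedModType R) :
  seminorm (fun x : E => `|x|).
Proof. by split=> [x y|a x]; [exact: ler_normD|exact: normrZ]. Qed.

Section seminorms.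
Context (R : realType) (V : lmodType R).
Implicit Types (q N : V -> R) (x y z : V).

Lemma seminorm0 q : seminorm q -> q 0 = 0.
Proof. by case=> _ qZ; rewrite -(scale0r 0) qZ normr0 mul0r. Qed.

Lemma seminormN q x : seminorm q -> q (- x) = q x.
Proof. by case=> _ qZ; rewrite -scaleN1r qZ normrN1 mul1r. Qed.

Lemma seminorm_ge0 q x : seminorm q -> 0 <= q x.
Proof.
move=> qs; have := qs.1 x (- x); rewrite subrr seminorm0// seminormN//.
by move=> ?; lra.
Qed.

(** The reverse inequality is the assumed one for [a^-1] and [a *: x]. *)
Lemma seminorm_le_homogeneous q :
  (forall x y, q (x + y) <= q x + q y) -> q 0 = 0 ->
  (forall (a : R) x, a != 0 -> q (a *: x) <= `|a| * q x) -> seminorm q.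
Proof.
move=> qD q0 qZ; split=> // a x; have [->|a0] := eqVneq a 0.
  by rewrite scale0r q0 normr0 mul0r.
apply/eqP; rewrite eq_le qZ//=.
have := qZ a^-1 (a *: x) (invr_neq0 a0); rewrite scalerA mulVf// scale1r.
by rewrite normfV mulrC ler_pdivlMr ?normr_gt0// mulrC.
Qed.

(** Subadditivity rests on comparability: the smaller of [q1] and [q2], taken at [x + y], is at most
    [q1 x + q2 y]. *)
Lemma seminorm_inf_chain (A : set (V -> R)) :
  A !=set0 -> (forall q, A q -> seminorm q) ->
  (forall q1 q2, A q1 -> A q2 ->
    (forall x, q1 x <= q2 x) \/ (forall x, q2 x <= q1 x)) ->
  seminorm (fun x => inf [set q x | q in A]).
Proof.
move=> [q0 Aq0] As Atot.
have ne x : [set q x | q in A] !=set0 by exists (q0 x), q0.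
have le_q q x : A q -> inf [set q x | q in A] <= q x.
  move=> Aq; apply: ge_inf; last by exists q.
  by exists 0 => _ [r /As rs <-]; exact: seminorm_ge0.
apply: seminorm_le_homogeneous => [x y||a x a0].
- rewrite -lerBlDr; apply: lb_le_inf => // _ [q1 Aq1 <-].
  rewrite lerBlDr -lerBlDl; apply: lb_le_inf => // _ [q2 Aq2 <-].
  rewrite lerBlDl; have [q12|q21] := Atot _ _ Aq1 Aq2.
    by have := le_q _ (x + y) Aq1; have := (As _ Aq1).1 x y; have := q12 y; lra.
  by have := le_q _ (x + y) Aq2; have := (As _ Aq2).1 x y; have := q21 x; lra.
- apply/eqP; rewrite eq_le -{1}(seminorm0 (As _ Aq0)) le_q//=.
  by apply: lb_le_inf => // _ [q /As qs <-]; rewrite seminorm0.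
- rewrite mulrC -ler_pdivrMr ?normr_gt0//.
  apply: lb_le_inf => // _ [q Aq <-].
  by rewrite ler_pdivrMr ?normr_gt0// mulrC -(As _ Aq).2 le_q.
Qed.

Lemma minimal_seminorm N (D : set V) : seminorm N ->
  exists q, [/\ seminorm q, forall x, q x <= N x,
    forall x, D x -> q x = N x &
    forall q', seminorm q' -> (forall x, q' x <= q x) ->
      (forall x, D x -> q' x = N x) -> forall x, q' x = q x].
Proof.
move=> Ns.
pose P q := [/\ seminorm q, forall x, q x <= N x & forall x, D x -> q x = N x].
pose T := {q | P q}.
(* The pointwise order is reversed, because [Zorn] yields maximal elements. *)
pose r : rel T := fun s t => `[< forall x, sval t x <= sval s x >].
have PN : P N by split.
have [||||[q [qs qN qD]] qmin] := @Zorn T r.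
- by move=> q; apply/asboolP.
- move=> q1 q2 q3 /asboolP q12 /asboolP q23; apply/asboolP => x.
  exact: le_trans (q23 x) (q12 x).
- move=> [q1 P1] [q2 P2] /asboolP/= q12 /asboolP/= q21; apply: eq_exist.
  by apply/funext => x; apply/eqP; rewrite eq_le q12 q21.
(* A nonempty chain is bounded by its pointwise infimum; the empty one, by [N]. *)
- move=> A Atot; have [A0|/nonemptyPn A0] := pselect (A !=set0); last first.
    by exists (exist _ _ PN) => s; rewrite A0.
  pose B := [set sval q | q in A].
  have B0 : B !=set0 by case: A0 => q Aq; exists (sval q), q.
  have Bs q : B q -> seminorm q by case=> -[? []] ? ? ? _ <-.
  have le_inf_q q x : B q -> inf [set q x | q in B] <= q x.
    move=> Bq; apply: ge_inf; last by exists q.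
    by exists 0 => _ [p /Bs ps <-]; exact: seminorm_ge0.
  have PB : P (fun x => inf [set q x | q in B]).
    split.
    + apply: seminorm_inf_chain => // _ _ [q1 A1 <-] [q2 A2 <-].
      by case: (Atot _ _ A1 A2) => /asboolP; [right|left].
    + case: B0 => q Bq x; apply: le_trans (le_inf_q _ x Bq) _.
      by case: Bq => -[? []] ? ? ? _ <-.
    + move=> x Dx; apply/eqP; rewrite eq_le; apply/andP; split.
        case: B0 => q Bq; apply: le_trans (le_inf_q _ x Bq) _.
        by case: Bq => -[? []] ? ? qD _ <- /=; rewrite qD.
      case: B0 => q0 Bq0; apply: lb_le_inf; first by exists (q0 x), q0.
      by move=> _ [_ [[q [? ? qD]] _ <-] <-] /=; rewrite qD.
  by exists (exist _ _ PB) => q Aq; apply/asboolP => x /=; apply: le_inf_q; exists q.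
- exists q; split=> // q' q's q'q q'D x.
  have Pq' : P q' by split=> // z; exact: le_trans (q'q z) (qN z).
  suff : exist P q' Pq' = exist P q (And3 qs qN qD) by move=> /(congr1 sval)/= ->.
  by apply: qmin; apply/asboolP.
Qed.

End seminorms.

(** * Infimal convolution along a linear map *)

(** Vectors [L w] may be subtracted at the cost [r w]. Multiples of one vector lower a seminorm
    there; free vectors of Y give the distance to Y. *)
Definition inf_conv (R : realType) (V W : lmodType R) (L : W -> V)
    (q : V -> R) (r : W -> R) (z : V) : R :=
  inf (range (fun w => q (z - L w) + r w)).

Section inf_convolution.
Context (R : realType) (V W : lmodType R) (L : W -> V) (L_linear : linear L).
Context (q : V -> R) (r : W -> R) (q_seminorm : seminorm q).
Context (rD : forall v w, r (v + w) <= r v + r w).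
Context (rZ : forall (a : R) w, r (a *: w) = `|a| * r w).
Context (qr_ge0 : forall w, 0 <= q (L w) + r w).

Let LZ (a : R) w : L (a *: w) = a *: L w.
Proof. exact: (GRing.scalable_linear L_linear). Qed.

Let LD v w : L (v + w) = L v + L w.
Proof. by have := L_linear 1 v w; rewrite !scale1r. Qed.

Let ne z : range (fun w => q (z - L w) + r w) !=set0.
Proof. by exists (q (z - L 0) + r 0), 0. Qed.

(** Since [q (L w) <= q (z - L w) + q z], [qr_ge0] keeps the infimum finite. *)
Let has_lb z : lbound (range (fun w => q (z - L w) + r w)) (- q z).
Proof.
move=> _ [w _ <-]; have := q_seminorm.1 (L w - z) z.
by rewrite subrK -opprB seminormN//; have := qr_ge0 w; lra.
Qed.

Lemma inf_conv_le z w : inf_conv L q r z <= q (z - L w) + r w.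
Proof. by apply: ge_inf; [exists (- q z); exact: has_lb|exists w]. Qed.

Lemma inf_conv_le_id z : inf_conv L q r z <= q z.
Proof.
(* The candidate is zero, written as a multiple so that [LZ] and [rZ] evaluate [L] and [r] there. *)
have := inf_conv_le z (0 *: 0).
by rewrite LZ rZ normr0 mul0r scale0r subr0 addr0.
Qed.

Lemma le_inf_conv z c :
  (forall w, c <= q (z - L w) + r w) -> c <= inf_conv L q r z.
Proof. by move=> cq; apply: lb_le_inf => // _ [w _ <-]. Qed.

(** Candidates [v] for [x] and [w] for [y] yield [v + w] for [x + y], and [a *: w] serves for a
    multiple by [a]. *)
Lemma inf_conv_seminorm : seminorm (inf_conv L q r).
Proof.
apply: seminorm_le_homogeneous => [x y||a x a0].
- rewrite -lerBlDr; apply: le_inf_conv => v.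
  rewrite lerBlDr -lerBlDl; apply: le_inf_conv => w; rewrite lerBlDl.
  have := inf_conv_le (x + y) (v + w); rewrite LD opprD addrACA.
  by have := q_seminorm.1 (x - L v) (y - L w); have := rD v w; lra.
- apply/eqP; rewrite eq_le -{1}(seminorm0 q_seminorm) inf_conv_le_id/=.
  by apply: le_inf_conv => w; rewrite sub0r seminormN.
- rewrite mulrC -ler_pdivrMr ?normr_gt0//.
  apply: le_inf_conv => w; rewrite ler_pdivrMr ?normr_gt0// mulrC mulrDr.
  by rewrite -q_seminorm.2 -rZ scalerBr -LZ inf_conv_le.
Qed.

End inf_convolution.

(** * Operator norm: bounds and near-attainment *)

Section operator_norm.
Context (R : realType) (X Z : normedModType R).
Implicit Types f T : X -> Z.

Let opnorm_ne f : [set `|f x| | x in [set x : X | `|x| <= 1]] !=set0.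
Proof. by exists `|f 0|, 0 => //=; rewrite normr0. Qed.

Let opnorm_bounded f : bounded_operator f ->
  has_ubound [set `|f x| | x in [set x : X | `|x| <= 1]].
Proof. by move=> [_ /(_ 1)[M fM]]; exists M => _ [x x1 <-]; exact: fM. Qed.

Lemma le_opnorm f x : bounded_operator f -> `|x| <= 1 -> `|f x| <= opnorm f.
Proof. by move=> /opnorm_bounded fb x1; apply: ub_le_sup => //; exists x. Qed.

Lemma opnorm_le f c : (forall x, `|x| <= 1 -> `|f x| <= c) -> opnorm f <= c.
Proof. by move=> fc; apply: ge_sup => // _ [x x1 <-]; exact: fc. Qed.

Lemma opnorm_adherent f e : bounded_operator f -> 0 < e ->
  exists2 x, `|x| <= 1 & opnorm f - e < `|f x|.
Proof.
move=> /opnorm_bounded fb e0.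
have [_ [x x1 <-] lt_fx] := sup_adherent e0 (conj (opnorm_ne f) fb).
by exists x.
Qed.

End operator_norm.

(** * Rank-one operators and the Daugavet equation *)

Section rank_one_operators.
Context (R : realType) (X Z : normedModType R).
Implicit Types (f : X -> R^o) (T : X -> Z) (z : Z).

Lemma bounded_operator_rank_one f z : bounded_operator f ->
  bounded_operator (fun x => f x *: z).
Proof.
move=> [fl fb]; split=> [a x y|r]; first by rewrite fl scalerDl scalerA.
have [M fM] := fb r; exists (M * `|z|) => x xr.
by rewrite normrZ ler_wpM2r// fM.
Qed.

Lemma rank_one_functional f z x0 : bounded_operator f -> f x0 = 1 ->
  z != 0 -> rank_one (fun x => f x *: z).
Proof.
move=> [fl _] fx0 z0; exists z => //; apply/seteqP; split=> _ [x _ <-].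
  by exists (f x).
exists (x *: x0) => //; congr (_ *: _).
by rewrite (GRing.scalable_linear fl) fx0; exact: mulr1.
Qed.

Lemma opnorm_rank_one f z : bounded_operator f ->
  opnorm (fun x => f x *: z) = opnorm f * `|z|.
Proof.
move=> fb; have Tb := bounded_operator_rank_one z fb.
apply/eqP; rewrite eq_le; apply/andP; split.
  by apply: opnorm_le => x x1; rewrite normrZ ler_wpM2r// le_opnorm.
have [->|z0] := eqVneq z 0.
  rewrite normr0 mulr0 (le_trans (normr_ge0 (f 0 *: (0 : Z))))//.
  by apply: (le_opnorm (bounded_operator_rank_one _ fb)); rewrite normr0.
rewrite -ler_pdivlMr ?normr_gt0//; apply: opnorm_le => x x1.
by rewrite ler_pdivlMr ?normr_gt0// -normrZ (le_opnorm Tb x1).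
Qed.

(** The range is the line through [z], so [f x] is the coefficient of [T x]; its uniqueness makes
    [f] linear, and [x0] is a preimage of [z]. *)
Lemma rank_one_factor T : bounded_operator T -> rank_one T ->
  exists f z x0, [/\ bounded_operator f, f x0 = 1, z != 0 &
    T = fun x => f x *: z].
Proof.
move=> [Tl Tb] [z z0 rT].
have /choice[f Tf] x : exists a : R, T x = a *: z.
  by have : range T (T x) by []; rewrite rT => -[a _ <-]; exists a.
have [x0 _ Tx0] : range T z by rewrite rT; exists 1; rewrite ?scale1r.
have cancel_z (a b : R) : a *: z = b *: z -> a = b.
  move=> /eqP; rewrite -subr_eq0 -scalerBl scaler_eq0 (negPf z0) orbF subr_eq0.
  by move/eqP.
exists f, z, x0; split=> //; last by apply/funext.
- split=> [a x y|r].
    by apply: cancel_z; rewrite -Tf Tl !Tf scalerA -scalerDl.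
  have [M TM] := Tb r; exists (M / `|z|) => x xr.
  by rewrite ler_pdivlMr ?normr_gt0// -normrZ -Tf TM.
- by apply: cancel_z; rewrite -Tf Tx0 scale1r.
Qed.

Lemma opnormD_le (S T : X -> Z) : bounded_operator S -> bounded_operator T ->
  opnorm (S \+ T) <= opnorm S + opnorm T.
Proof.
move=> Sb Tb; apply: opnorm_le => x x1.
by rewrite (le_trans (ler_normD _ _))// lerD// le_opnorm.
Qed.

Lemma bounded_operatorD (S T : X -> Z) : bounded_operator S ->
  bounded_operator T -> bounded_operator (S \+ T).
Proof.
move=> [Sl Sb] [Tl Tb]; split=> [a x y|r] /=.
  by rewrite Sl Tl scalerDr addrACA.
have [M SM] := Sb r; have [N TN] := Tb r; exists (M + N) => x xr.
by rewrite (le_trans (ler_normD _ _))// lerD ?SM ?TN.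
Qed.

(** As [|G x|] is at most [opnorm G], a point where the sum nearly attains its norm must nearly
    attain that of [f] as well. *)
Lemma daugavet_center_approx (G : X -> Z) f x0 z e : daugavet_center G ->
  bounded_operator f -> f x0 = 1 -> 0 < e ->
  exists x, [/\ `|x| <= 1, opnorm f - e < `|f x| &
    opnorm G + opnorm f * `|z| - e < `|G x + f x *: z|].
Proof.
move=> [Gb GT] fb fx0 e0.
have approx y : y != 0 -> exists x, [/\ `|x| <= 1, opnorm f - e < `|f x| &
    opnorm G + opnorm f * `|y| - e < `|G x + f x *: y|].
  move=> y0; have y_gt0 : 0 < `|y| by rewrite normr_gt0.
  have Tb := bounded_operator_rank_one y fb.
  (* The second bound becomes [e] on division by the norm of [y]. *)
  have d0 : 0 < Num.min e (e * `|y|) by rewrite lt_min e0 mulr_gt0.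
  have [x x1] := opnorm_adherent (bounded_operatorD Gb Tb) d0.
  rewrite (GT _ Tb (rank_one_functional fb fx0 y0)) opnorm_rank_one//= => lt_x.
  exists x; split=> //; last first.
    by apply: le_lt_trans lt_x; rewrite lerD2l lerN2 ge_min lexx.
  rewrite -(ltr_pM2r y_gt0) mulrBl.
  have le_e : Num.min e (e * `|y|) <= e * `|y| by rewrite ge_min lexx orbT.
  have := ler_normD (G x) (f x *: y); rewrite normrZ.
  by have := le_opnorm Gb x1; move: lt_x; lra.
(* For [z = 0] the operator is not of rank one: the point found for any nonzero vector works, and if
   [Z] is trivial then [G] vanishes. *)
have [z0|] := eqVneq z 0; last exact: approx.
rewrite {z}z0; have [[z z0]|Z0] := pselect (exists z : Z, z != 0).
  have [x [x1 fx Gx]] := approx z z0; exists x; split=> //.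
  rewrite scaler0 addr0 normr0 mulr0 addr0.
  have : `|f x| * `|z| <= opnorm f * `|z| by rewrite ler_wpM2r// le_opnorm.
  by have := ler_normD (G x) (f x *: z); rewrite normrZ; move: Gx; lra.
have [x x1 fx] := opnorm_adherent fb e0; exists x; split=> //.
rewrite normr0 mulr0 addr0 scaler0 addr0.
suff : opnorm G <= 0 by have := normr_ge0 (G x); lra.
apply: opnorm_le => y _; suff -> : G y = 0 by rewrite normr0.
by apply: contrapT => /eqP Gy; apply: Z0; exists (G y).
Qed.

End rank_one_operators.

(** * The Daugavet estimate under a minimal seminorm, for all vectors of E *)

Lemma minimal_extension_approx (R : realType) (X E : normedModType R)
    (S : pred E) (Y : subLmodType S)
    (G : X -> with_norm (restricted_norm Y)) (q : E -> R)
    (f : X -> R^o) (x0 : X) (z : E) (e : R) :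
  daugavet_center G ->
  seminorm q -> (forall y : Y, q (val y) = `|val y|) ->
  (forall q', seminorm q' -> (forall x, q' x <= q x) ->
    (forall y : Y, q' (val y) = `|val y|) -> forall x, q' x = q x) ->
  bounded_operator f -> f x0 = 1 -> 0 < e ->
  exists x, [/\ `|x| <= 1, opnorm f - e < `|f x| &
    opnorm G + opnorm f * q z - e < q (val (G x : Y) + f x *: z)].
Proof.
move=> Gd qs qY q_min fb fx0 e0; apply: contrapT => nex.
have F0 : 0 < opnorm f.
  have x0_gt0 : 0 < `|x0|.
    rewrite normr_gt0; apply/eqP => x00.
    have f0 : f x0 = 0.
      rewrite x00 -(scale0r (0 : X)) (GRing.scalable_linear fb.1).
      exact: scale0r.
    by move: fx0; rewrite f0 => /eqP; rewrite eq_sym oner_eq0.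
  apply: lt_le_trans (le_opnorm fb (_ : `|(`|x0|^-1 *: x0)| <= 1)); last first.
    by rewrite normrZ normfV normr_id mulVf// gt_eqF.
  rewrite (GRing.scalable_linear fb.1) fx0 normr_gt0 /=.
  by rewrite scaler_eq0 negb_or invr_eq0 oner_eq0 gt_eqF.
have le1 (y : Y) : `|val y| <= q (val y - z) + (q z - e / opnorm f).
  apply/ler_addgt0Pr => d d0.
  (* The bound [e] makes [nex] applicable to the point obtained; [opnorm f * d] becomes [d] after
     division by [opnorm f]. *)
  have d'0 : 0 < Num.min e (opnorm f * d) by rewrite lt_min e0 mulr_gt0.
  have [x [x1 fx Gx]] :=
    daugavet_center_approx (y : with_norm (restricted_norm Y)) Gd fb fx0 d'0.
  have {}Gx : opnorm G + opnorm f * `|val y| - Num.min e (opnorm f * d) <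
      `|val ((G x : Y) + f x *: y)| := Gx.
  have le_e : Num.min e (opnorm f * d) <= e by rewrite ge_min lexx.
  have le_d : Num.min e (opnorm f * d) <= opnorm f * d.
    by rewrite ge_min lexx orbT.
  have qx : q (val (G x : Y) + f x *: z) <= opnorm G + opnorm f * q z - e.
    by rewrite leNgt; apply/negP => ?; apply: nex; exists x; split=> //; lra.
  have h0 : `|val ((G x : Y) + f x *: y)| <=
      q (val (G x : Y) + f x *: z) + `|f x| * q (val y - z).
    rewrite -qs.2; apply: le_trans (qs.1 _ _).
    by rewrite scalerBr -addrA (addrC (f x *: z)) subrK -linearZ -linearD qY.
  have h1 : `|f x| * q (val y - z) <= opnorm f * q (val y - z).
    by rewrite ler_wpM2r ?seminorm_ge0// le_opnorm.
  rewrite -(ler_pM2l F0) !mulrDr mulrN (mulrCA _ e) mulfV ?gt_eqF// mulr1.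
  lra.
have e_F : 0 < e / opnorm f by rewrite divr_gt0.
(* At [y = 0], [le1] reads [e / opnorm f <= 2 * q z]. *)
have qz : 0 < q z.
  by have := le1 0; rewrite linear0 normr0 sub0r seminormN//; lra.
(* Truncation at 0 makes the cost [|t| * k] a seminorm in [t]. *)
pose k := Num.max (q z - e / opnorm f) 0.
have k_lt : k < q z by rewrite gt_max qz andbT; lra.
have k_ge0 : 0 <= k by rewrite le_max lexx orbT.
have le_k (y : Y) : `|val y| <= q (val y - z) + k.
  by apply: le_trans (le1 y) _; rewrite lerD2l le_max lexx.
have leY (y : Y) (t : R) : `|val y| <= q (val y - t *: z) + `|t| * k.
  have [->|t0] := eqVneq t 0.
    by rewrite scale0r subr0 normr0 mul0r addr0 qY.
  (* Multiplying by [|t|] turns this into the claim. *)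
  have := le_k (t^-1 *: y).
  rewrite -(ler_pM2l (_ : 0 < `|t|)) ?normr_gt0// mulrDr -normrZ -qs.2.
  by rewrite scalerBr linearZ scalerA mulfV// scale1r.
pose Lz (t : R^o) : E := t *: z.
have Lz_linear : linear Lz.
  by move=> a s t; rewrite /Lz scalerDl scalerA.
pose r (t : R^o) := `|t| * k.
have rZ (a : R) t : r (a *: t) = `|a| * r t by rewrite /r normrM mulrA.
have rD s t : r (s + t) <= r s + r t.
  by rewrite /r -mulrDl ler_wpM2r// ler_normD.
have qr t : 0 <= q (Lz t) + r t.
  by rewrite addr_ge0 ?seminorm_ge0// mulr_ge0.
have le_id := inf_conv_le_id Lz_linear qs rZ qr.
have q'Y (y : Y) : inf_conv Lz q r (val y) = `|val y|.
  apply/eqP; rewrite eq_le -{1}qY le_id/=.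
  by apply: le_inf_conv => t; exact: leY.
have q'z := q_min _ (inf_conv_seminorm Lz_linear qs rD rZ qr) le_id q'Y z.
(* Subtracting [z] itself costs [k < q z], against minimality. *)
have := inf_conv_le (L := Lz) qs qr z 1.
by rewrite q'z /Lz scale1r subrr seminorm0// add0r /r normr1 mul1r leNgt k_lt.
Qed.

(** * The distance to Y and the renorming *)

Lemma distance_seminorm (R : realType) (E : normedModType R) (S : pred E)
    (Y : subLmodType S) : exists d : E -> R,
  [/\ seminorm d, forall z, d z <= `|z|, forall (y : Y) z, d (val y + z) = d z &
    forall z c, (forall y : Y, c <= `|z - val y|) -> c <= d z].
Proof.
have val_linear : linear (val : Y -> E) := linearP (val : {linear Y -> E}).
have rD (v w : Y) : (0 : R) <= 0 + 0 by rewrite addr0.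
have rZ (a : R) (w : Y) : 0 = `|a| * 0 by rewrite mulr0.
have r_ge0 (w : Y) : 0 <= `|val w| + 0 by rewrite addr0.
pose d := inf_conv (val : Y -> E) (fun x : E => `|x|) (fun=> 0).
have ds : seminorm d := inf_conv_seminorm val_linear (norm_seminorm E) rD rZ r_ge0.
have dY (y : Y) : d (val y) = 0.
  apply/eqP; rewrite eq_le seminorm_ge0// andbT.
  have := inf_conv_le (norm_seminorm E) r_ge0 (val y) y.
  by rewrite subrr normr0 addr0.
exists d; split=> //.
- exact: (inf_conv_le_id val_linear (norm_seminorm E) rZ r_ge0).
(* Since [d] vanishes on Y, the triangle inequality gives both directions. *)
- move=> y z; apply/eqP; rewrite eq_le; apply/andP; split.
    by have := ds.1 (val y) z; rewrite dY add0r.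
  by have := ds.1 (- val y) (val y + z); rewrite (seminormN _ ds) dY add0r addKr.
- by move=> z c cz; apply: le_inf_conv => y; rewrite addr0.
Qed.

Theorem theorem1p3 (R : realType) (X E : completeNormedModType R)
    (S : pred E) (Y : subLmodType S) (S_closed : closed [set x : E | x \in S])
    (G : X -> with_norm (restricted_norm Y)) :
  daugavet_center G ->
  exists p : vnorm E,
    [/\ equivalent_to_norm p,
        forall y : Y, p (val y) = `|val y| &
        daugavet_center ((val : Y -> E) \o G : X -> with_norm p)].
Proof.
move=> Gd.
have [q [qs q_le qY q_min]] :=
  minimal_seminorm (range (val : Y -> E)) (norm_seminorm E).
have {}qY (y : Y) : q (val y) = `|val y| by apply: qY; exists y.
have {}q_min q' : seminorm q' -> (forall x, q' x <= q x) ->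
    (forall y : Y, q' (val y) = `|val y|) -> forall x, q' x = q x.
  by move=> q's q'q q'Y; apply: q_min => // _ [y _ <-].
have [d [ds d_le d_transl d_ge]] := distance_seminorm Y.
have dY (y : Y) : d (val y) = 0 by rewrite -[val y]addr0 d_transl seminorm0.
(* For [y] in Y, [|y| = q y <= |z - y| + q z], hence [|z| - q z <= 2 * |z - y|]; then take the
   infimum over [y]. *)
have norm_le z : `|z| <= 2 * (q z + d z).
  suff : (`|z| - q z) / 2 <= d z by have := seminorm_ge0 z qs; lra.
  apply: d_ge => y.
  have := ler_normD (z - val y) (val y); rewrite subrK.
  have := qs.1 (val y - z) z; rewrite subrK qY.
  by have := q_le (val y - z); rewrite distrC; lra.
have pD x y : q (x + y) + d (x + y) <= (q x + d x) + (q y + d y).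
  by rewrite addrACA lerD ?qs.1 ?ds.1.
have pZ (a : R) x : q (a *: x) + d (a *: x) = `|a| * (q x + d x).
  by rewrite qs.2 ds.2 mulrDr.
have p0 x : q x + d x = 0 -> x = 0.
  move=> x0; apply/eqP; rewrite -normr_le0.
  by have := norm_le x; rewrite x0 mulr0.
pose p := VNorm pD pZ p0; exists p; split.
- exists 2^-1, 2; split; [by rewrite invr_gt0|exact: ltr0Sn|move=> x; split].
    by have := norm_le x; rewrite /=; lra.
  by have := q_le x; have := d_le x; rewrite /=; lra.
- by move=> y; rewrite /= qY dY addr0.
have pY (y : Y) : p (val y) = `|val y| by rewrite /= qY dY addr0.
pose JG : X -> with_norm p := (val : Y -> E) \o G.
have JG_norm x : `|JG x| = `|G x| by exact: pY.
have [[Gl Gb] _] := Gd.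
have JGb : bounded_operator JG.
  split=> [a x y|r]; last first.
    by have [M GM] := Gb r; exists M => x /GM; rewrite JG_norm.
  by rewrite /JG /= Gl; exact: (linearP (val : {linear Y -> E})).
have opnorm_JG : opnorm JG = opnorm G.
  by congr sup; apply/seteqP; split=> _ [x x1 <-]; exists x => //; rewrite JG_norm.
(* Only the lower bound on the norm of the sum remains. *)
split=> // T Tb Tr; apply/eqP; rewrite eq_le opnormD_le//=.
have [f [z [x0 [fb fx0 z0 ->]]]] := rank_one_factor Tb Tr.
rewrite opnorm_rank_one// opnorm_JG.
apply/ler_addgt0Pr => e e0.
have dz0 : 0 < 1 + d z by rewrite ltr_pwDl// seminorm_ge0.
(* This tolerance is lost once in the estimate for [q] and [d z] times in that for [d], in total
   [e]. *)
have e'0 : 0 < e / (1 + d z) by rewrite divr_gt0.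
have [x [x1 fx qx]] := minimal_extension_approx (z : E) Gd qs qY q_min fb fx0 e'0.
have le_x := le_opnorm (bounded_operatorD JGb (bounded_operator_rank_one z fb)) x1.
have d_x : d (val (G x : Y) + f x *: z) = `|f x| * d z by rewrite d_transl ds.2.
have d_ge_x : (opnorm f - e / (1 + d z)) * d z <= `|f x| * d z.
  by rewrite ler_wpM2r ?seminorm_ge0// ltW.
have e_split : e / (1 + d z) + e / (1 + d z) * d z = e.
  by rewrite -{1}[e / (1 + d z)]mulr1 -mulrDr divfK// gt_eqF.
have zE : `|z| = q z + d z by [].
have xE : `|JG x + f x *: z| =
    q (val (G x : Y) + f x *: z) + d (val (G x : Y) + f x *: z) by [].
rewrite zE; move: le_x; rewrite /= xE d_x mulrBl in d_ge_x *.
by rewrite mulrDr; lra.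
Qed.
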